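(* Let $n\ge 1$ be an integer, let $U_q(sl_{n+1},tor)$ be the quantum toroidal algebra and let $\mathcal{U}_0$ be the algebra given by the finite presentation described in the context. Then there exists an epimorphism (surjective homomorphism) of $\mathbb{C}(q)$-algebras $\pi:\mathcal{U}_0\longrightarrow U_q(sl_{n+1},tor)$ which is the identity on the generators of $\mathcal{U}_0$, i.e. $\pi$ sends each of the generators $x_i^{\pm}(0)$, $x_0^+(-1)$, $x_0^-(1)$, $K_i^{\pm1}$ ($i\in I$), $q^{\pm d_1}$, $q^{\pm d_2}$, $\gamma^{\pm\frac12}$ of $\mathcal{U}_0$ to the generator of $U_q(sl_{n+1},tor)$ denoted by the same symbol. That is, $\mathcal{U}_0/\ker\pi\cong U_q(sl_{n+1},tor)$.
   Context: Notation. $I=\{0,1,\dots,n\}$; $A=(a_{ij})_{i,j\in I}$ is the generalized Cartan matrix of affine type $A_n^{(1)}$, and $(\alpha_i,\alpha_j)=a_{ij}$. For $v\neq 0$, $[a,b]_v=ab-v\,ba$ and $[a,b]=[a,b]_1$. $[m]=\frac{q^m-q^{-m}}{q-q^{-1}}$, $[m]!=[m]\cdots[1]$, $\left[{m\atop k}\right]=\frac{[m]!}{[k]!\,[m-k]!}$. Algebras are unital associative over $\mathbb{C}(q)$. $\epsilon$ ranges over $\pm$, identified with $\pm1$. All symbols $K_i^{\pm1},q^{\pm d_1},q^{\pm d_2},\gamma^{\pm 1/2}$ denote mutually inverse pairs. Quantum toroidal algebra. $U_q(sl_{n+1},tor)$ is generated by $x_i^{\pm}(k)$, $a_i(r)$,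 $K_i^{\pm1}$, $\gamma^{\pm\frac12}$, $q^{\pm d_1}$, $q^{\pm d_2}$ ($i\in I$, $k\in\mathbb{Z}$, $r\in\mathbb{Z}\setminus\{0\}$) with relations: (1) $\gamma^{\pm\frac12}$ are central; the $K_i^{\pm1}$, $q^{\pm d_1},q^{\pm d_2}$ commute with each other, and the $K_i^{\pm1}$ commute with the $a_j(r)$; (2) $K_ix_j^{\pm}(k)K_i^{-1}=q^{\pm a_{ij}}x_j^{\pm}(k)$; (3) $q^{d_1}a_i(r)q^{-d_1}=q^ra_i(r)$, $q^{d_1}x_i^{\pm}(k)q^{-d_1}=q^kx_i^{\pm}(k)$, $q^{d_2}a_i(r)q^{-d_2}=a_i(r)$, $q^{d_2}x_i^{\pm}(k)q^{-d_2}=q^{\pm\delta_{i0}}x_i^{\pm}(k)$; (4) $[a_i(r),a_j(r')]=\delta_{r+r',0}\frac{[ra_{ij}]}{r}\frac{\gamma^r-\gamma^{-r}}{q-q^{-1}}$; (5) $[a_i(r),x_j^{\pm}(k)]=\pm\frac{[ra_{ij}]}{r}\gamma^{\mp\frac{|r|}{2}}x_j^{\pm}(r+k)$; (6) $[x_i^{\pm}(k+1),x_j^{\pm}(l)]_{q^{\pm(\alpha_i,\alpha_j)}}=-[x_j^{\pm}(l+1),x_i^{\pm}(k)]_{q^{\pm(\alpha_i,\alpha_j)}}$; (7) $[x_i^+(k),x_j^-(k')]=\frac{\delta_{ij}}{q-q^{-1}}\left(\gamma^{\frac{k-k'}2}\phi_i(k+k')-\gamma^{\frac{k'-k}2}\varphi_i(k+k')\right)$,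 where $\phi_i(m)=0$ for $m<0$, $\varphi_i(m)=0$ for $m>0$, and $\sum_{m\ge0}\phi_i(m)z^{-m}=K_i\exp\left((q-q^{-1})\sum_{r\ge1}a_i(r)z^{-r}\right)$, $\sum_{m\ge0}\varphi_i(-m)z^{m}=K_i^{-1}\exp\left(-(q-q^{-1})\sum_{r\ge1}a_i(-r)z^{r}\right)$; (8) for $i\ne j$ and $N=1-a_{ij}$: $\mathrm{Sym}_{m_1,\dots,m_N}\sum_{k=0}^N(-1)^k\left[{N\atop k}\right]x_i^{\pm}(m_1)\cdots x_i^{\pm}(m_k)x_j^{\pm}(l)x_i^{\pm}(m_{k+1})\cdots x_i^{\pm}(m_N)=0$, where $\mathrm{Sym}$ denotes symmetrization in $(m_1,\dots,m_N)$. The algebra $\mathcal{U}_0$ is generated by $x_i^{\pm}(0)$, $x_0^+(-1)$, $x_0^-(1)$, $K_i^{\pm1}$ ($i\in I$), $q^{\pm d_1}$, $q^{\pm d_2}$, $\gamma^{\pm\frac12}$ with relations: (i) $\gamma^{\pm\frac12}$ are central; $K_i^{\pm1}$, $q^{\pm d_1}$, $q^{\pm d_2}$ commute with each other; (ii) $K_ix_j^{\pm}(0)K_i^{-1}=q^{\pm a_{ij}}x_j^{\pm}(0)$, $K_ix_0^{\epsilon}(-\epsilon)K_i^{-1}=q^{\epsilon a_{i0}}x_0^{\epsilon}(-\epsilon)$; (iii) $q^{d_1}x_i^{\pm}(0)q^{-d_1}=x_i^{\pm}(0)$, $q^{d_1}x_0^{\epsilon}(-\epsilon)q^{-d_1}=q^{-\epsilon}x_0^{\epsilon}(-\epsilon)$;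 (iv) $q^{d_2}x_i^{\pm}(0)q^{-d_2}=q^{\pm\delta_{i0}}x_i^{\pm}(0)$, $q^{d_2}x_0^{\epsilon}(-\epsilon)q^{-d_2}=q^{\epsilon}x_0^{\epsilon}(-\epsilon)$; (v) $[x_0^{\epsilon}(-\epsilon),x_0^{\epsilon}(0)]_{q^{-2}}=0$; (vi) $[x_i^+(0),x_j^-(0)]=\delta_{ij}\frac{K_i-K_i^{-1}}{q-q^{-1}}$, $[x_0^+(-1),x_0^-(1)]=\frac{\gamma^{-1}K_0-\gamma K_0^{-1}}{q-q^{-1}}$; (vii) $[x_i^{-\epsilon}(0),x_0^{\epsilon}(-\epsilon)]=0$ for $i\neq0$; (viii) $[x_i^{\pm}(0),x_j^{\pm}(0)]=0$ if $a_{ij}=0$, and $[x_0^{\epsilon}(-\epsilon),x_k^{\epsilon}(0)]=0$ if $a_{0k}=0$; (ix) $x_i^{\pm}(0)^2x_j^{\pm}(0)-[2]x_i^{\pm}(0)x_j^{\pm}(0)x_i^{\pm}(0)+x_j^{\pm}(0)x_i^{\pm}(0)^2=0$ if $a_{ij}=-1$; (x) $x_j^{\epsilon}(0)^2x_0^{\epsilon}(-\epsilon)-[2]x_j^{\epsilon}(0)x_0^{\epsilon}(-\epsilon)x_j^{\epsilon}(0)+x_0^{\epsilon}(-\epsilon)x_j^{\epsilon}(0)^2=0$ if $a_{0j}=-1$; (xi) if $a_{0j}=-1$: $x_0^{\epsilon}(-\epsilon)x_0^{\epsilon}(0)x_j^{\epsilon}(0)-[2]x_0^{\epsilon}(-\epsilon)x_j^{\epsilon}(0)x_0^{\epsilon}(0)+x_j^{\epsilon}(0)x_0^{\epsilon}(-\epsilon)x_0^{\epsilon}(0)+x_0^{\epsilon}(0)x_0^{\epsilon}(-\epsilon)x_j^{\epsilon}(0)-[2]x_0^{\epsilon}(0)x_j^{\epsilon}(0)x_0^{\epsilon}(-\epsilon)+x_j^{\epsilon}(0)x_0^{\epsilon}(0)x_0^{\epsilon}(-\epsilon)=0$.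 *)

(* Defs.v *)
From HB Require Import structures.
From mathcomp Require Import all_boot all_order all_algebra.
From mathcomp Require Import perm complex boolp reals.
From mathcomp Require Import finmap monalg.

Set Implicit Arguments.
Unset Strict Implicit.
Unset Printing Implicit Defensive.

Import GRing.Theory Num.Theory.
Local Open Scope ring_scope.
Local Open Scope quotient_scope.

(* [idealr] of ring_quotient is a proper left ideal; adding closure under
   multiplication on the right gives proper two-sided ideals. *)
HB.mixin Record isRightMulClosed (A : nzRingType) (S : A -> bool) := {
  rightMulClosed_subproof : forall a u : A, S u -> S (u * a)
}.

#[short(type="twoSidedIdeal")]
HB.structure Definition TwoSidedIdeal (A : nzRingType) :=
  {S of Idealr A S & isRightMulClosed A S}.

Section QuotAlg.
Variables (F : fieldType) (A : algType F) (J : twoSidedIdeal A).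

Lemma twoSidedIdealMl a u : u \in J -> u * a \in J.
Proof. exact: (rightMulClosed_subproof a u). Qed.

Definition quotAlg : Type := Quotient.quot J.

HB.instance Definition _ := GRing.Zmodule.on quotAlg.

Definition quotClass (x : A) : quotAlg := \pi_(Quotient.quot J) x.
Definition quotRepr (x : quotAlg) : A := repr (x : Quotient.quot J).

Lemma quotReprK x : quotClass (quotRepr x) = x.
Proof. exact: reprK. Qed.

Lemma quotClassP x y : reflect (quotClass x = quotClass y) (x - y \in J).
Proof. by rewrite Quotient.idealrBE; apply: eqP. Qed.

Lemma quotClass_is_zmod : zmod_morphism quotClass.
Proof. exact: (@pi_is_zmod_morphism _ _ _ (Quotient.quot J)). Qed.

HB.instance Definition _ :=
  GRing.isZmodMorphism.Build A quotAlg quotClass quotClass_is_zmod.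

Definition quotMul (x y : quotAlg) := quotClass (quotRepr x * quotRepr y).
Definition quotScale (c : F) (x : quotAlg) := quotClass (c *: quotRepr x).

Lemma quotClassM x y : quotMul (quotClass x) (quotClass y) = quotClass (x * y).
Proof.
apply/quotClassP; set x' := quotRepr _; set y' := quotRepr _.
have -> : x' * y' - x * y = (x' - x) * y' + x * (y' - y).
  by rewrite mulrBl mulrBr addrA subrK.
rewrite rpredD //.
  by apply: twoSidedIdealMl; apply/quotClassP; rewrite quotReprK.
by apply: idealMr; apply/quotClassP; rewrite quotReprK.
Qed.

Lemma quotClassZ c x : quotScale c (quotClass x) = quotClass (c *: x).
Proof.
apply/quotClassP; rewrite -scalerBr -[_ - _]mul1r scalerAl.
by apply: idealMr; apply/quotClassP; rewrite quotReprK.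
Qed.

Local Notation E := (quotClassM, quotClassZ).

Lemma quotMulA : associative quotMul.
Proof.
by move=> x y z; rewrite -[x]quotReprK -[y]quotReprK -[z]quotReprK !E mulrA.
Qed.

Lemma quotMul1l : left_id (quotClass 1) quotMul.
Proof. by move=> x; rewrite -[x]quotReprK !E mul1r. Qed.

Lemma quotMul1r : right_id (quotClass 1) quotMul.
Proof. by move=> x; rewrite -[x]quotReprK !E mulr1. Qed.

Lemma quotMulDl : left_distributive quotMul +%R.
Proof.
move=> x y z; rewrite -[x]quotReprK -[y]quotReprK -[z]quotReprK.
by rewrite -raddfD !E mulrDl raddfD.
Qed.

Lemma quotMulDr : right_distributive quotMul +%R.
Proof.
move=> x y z; rewrite -[x]quotReprK -[y]quotReprK -[z]quotReprK.
by rewrite -raddfD !E mulrDr raddfD.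
Qed.

Lemma quot1_neq0 : quotClass 1 != 0.
Proof.
rewrite -(raddf0 quotClass); apply/eqP => /quotClassP.
by rewrite subr0 idealr1.
Qed.

HB.instance Definition _ := GRing.Zmodule_isNzRing.Build quotAlg
  quotMulA quotMul1l quotMul1r quotMulDl quotMulDr quot1_neq0.

Lemma quotScaleA a b v : quotScale a (quotScale b v) = quotScale (a * b) v.
Proof. by rewrite -[v]quotReprK !E scalerA. Qed.

Lemma quotScale1 : left_id 1 quotScale.
Proof. by move=> v; rewrite -[v]quotReprK !E scale1r. Qed.

Lemma quotScaleDr : right_distributive quotScale +%R.
Proof.
move=> a u v; rewrite -[u]quotReprK -[v]quotReprK.
by rewrite -raddfD !E scalerDr raddfD.
Qed.

Lemma quotScaleDl v : {morph quotScale^~ v : a b / a + b}.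
Proof. by move=> a b; rewrite -[v]quotReprK !E scalerDl raddfD. Qed.

HB.instance Definition _ := GRing.Zmodule_isLmodule.Build F quotAlg
  quotScaleA quotScale1 quotScaleDr quotScaleDl.

Lemma quotScaleAl (a : F) (u v : quotAlg) : a *: (u * v) = (a *: u) * v.
Proof.
rewrite -[u]quotReprK -[v]quotReprK /GRing.scale /GRing.mul /=.
by rewrite !E scalerAl.
Qed.

HB.instance Definition _ :=
  GRing.Lmodule_isLalgebra.Build F quotAlg quotScaleAl.

Lemma quotScaleAr (a : F) (u v : quotAlg) : a *: (u * v) = u * (a *: v).
Proof.
rewrite -[u]quotReprK -[v]quotReprK /GRing.scale /GRing.mul /=.
by rewrite !E scalerAr.
Qed.

HB.instance Definition _ :=
  GRing.Lalgebra_isAlgebra.Build F quotAlg quotScaleAr.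

Lemma quotClass_is_monoid_morphism : monoid_morphism quotClass.
Proof. by split=> // x y; rewrite -quotClassM. Qed.

HB.instance Definition _ :=
  GRing.isMonoidMorphism.Build A quotAlg quotClass quotClass_is_monoid_morphism.

Lemma quotClass_is_scalable : scalable quotClass.
Proof. by move=> c x; rewrite -quotClassZ. Qed.

HB.instance Definition _ :=
  GRing.isScalable.Build F A quotAlg *:%R quotClass quotClass_is_scalable.

End QuotAlg.

Section KernelIdeal.
Variables (F : fieldType) (A B : algType F) (f : {lrmorphism A -> B}).

Definition kerIdeal : A -> bool := fun x => f x == 0.

Lemma kerIdeal_closed : idealr_closed kerIdeal.
Proof.
split; rewrite /in_mem /= /kerIdeal ?rmorph0 ?rmorph1 ?oner_eq0 //.
by move=> a x y /eqP fx /eqP fy; rewrite rmorphD rmorphM /= fx fy mulr0 add0r.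
Qed.

HB.instance Definition _ := isIdealr.Build A kerIdeal kerIdeal_closed.

Lemma kerIdeal_rightMulClosed (a u : A) : kerIdeal u -> kerIdeal (u * a).
Proof. by rewrite /kerIdeal rmorphM /= => /eqP ->; rewrite mul0r. Qed.

HB.instance Definition _ :=
  isRightMulClosed.Build A kerIdeal kerIdeal_rightMulClosed.

End KernelIdeal.

Section GeneratedIdeal.
Variable A : nzRingType.

(* The two-sided ideal generated by the differences [l - r] with [rel l r]. *)
Inductive idealGen (rel : A -> A -> Prop) : A -> Prop :=
| idealGen_rel l r : rel l r -> idealGen rel (l - r)
| idealGen_0 : idealGen rel 0
| idealGen_D x y : idealGen rel x -> idealGen rel y -> idealGen rel (x + y)
| idealGen_Ml a x : idealGen rel x -> idealGen rel (a * x)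
| idealGen_Mr a x : idealGen rel x -> idealGen rel (x * a).

Lemma idealGen_proper (B : nzRingType) (f : {rmorphism A -> B})
    (rel : A -> A -> Prop) :
  (forall l r, rel l r -> f l = f r) -> ~ idealGen rel 1.
Proof.
move=> f_rel I1; have ker x : idealGen rel x -> f x = 0.
  elim=> [l r /f_rel e||u v _ fu _ fv|a u _ fu|a u _ fu].
  - by rewrite rmorphB e subrr.
  - exact: rmorph0.
  - by rewrite rmorphD fu fv addr0.
  - by rewrite rmorphM fu mulr0.
  - by rewrite rmorphM fu mul0r.
by have /eqP := ker _ I1; rewrite rmorph1 oner_eq0.
Qed.

Variables (rel : A -> A -> Prop) (rel_proper : ~ idealGen rel 1).

Definition genIdeal (_ : ~ idealGen rel 1) : A -> bool :=
  fun x => `[< idealGen rel x >].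
Local Notation J := (genIdeal rel_proper).

Lemma genIdeal_closed : idealr_closed J.
Proof.
split; rewrite /in_mem /= /genIdeal.
- by apply/asboolP; apply: idealGen_0.
- exact/asboolP.
move=> a x y /asboolP Ix /asboolP Iy; apply/asboolP.
by apply: idealGen_D => //; apply: idealGen_Ml.
Qed.

HB.instance Definition _ := isIdealr.Build A J genIdeal_closed.

Lemma genIdeal_rightMulClosed (a u : A) : J u -> J (u * a).
Proof. by move=> /asboolP Iu; apply/asboolP/idealGen_Mr. Qed.

HB.instance Definition _ := isRightMulClosed.Build A J genIdeal_rightMulClosed.

End GeneratedIdeal.

(* The free associative unital algebra, as the algebra of the free monoid. *)
Section FreeAlg.
Variables (F : fieldType) (G : choiceType).

Lemma malg_scalerAr (c : F) (x y : {malg F[{fmonom G}]}) :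
  c *: (x * y) = x * (c *: y).
Proof.
apply/malgP => k; rewrite [LHS]mcoeffZ [in LHS]mcoeffMl.
rewrite [RHS](mcoeffMlw k (fsubset_refl (msupp x)) (msuppZ_le c y)).
rewrite mulr_sumr; apply: eq_bigr => i _; rewrite mulr_sumr.
by apply: eq_bigr => j _; rewrite mcoeffZ mulrnAr mulrCA.
Qed.

Definition freeAlg : Type := {malg F[{fmonom G}]}.

HB.instance Definition _ := GRing.Lalgebra.on freeAlg.
HB.instance Definition _ :=
  GRing.Lalgebra_isAlgebra.Build F freeAlg malg_scalerAr.

Definition gen (g : G) : freeAlg := << fmu g >>.

Section FreeEval.
Variable h : G -> F.

Definition monomEval (m : {fmonom G}) : F := \prod_(g <- (m : seq G)) h g.

Lemma monomEval_mmorphism : mmorphism monomEval.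
Proof.
split=> [x y|]; rewrite /monomEval; first by rewrite fmM big_cat.
by rewrite fm1 big_nil.
Qed.

HB.instance Definition _ :=
  monalg.isMultiplicative.Build {fmonom G} F monomEval monomEval_mmorphism.

Definition freeEval : freeAlg -> F := mmap idfun monomEval.

HB.instance Definition _ := GRing.RMorphism.on freeEval.
HB.instance Definition _ := GRing.Linear.on freeEval.

Lemma freeEval_exists :
  exists ev : {lrmorphism freeAlg -> F | *%R}, forall g, ev (gen g) = h g.
Proof.
exists freeEval => g.
by rewrite /= /freeEval mmapU /= mul1r /monomEval fmU big_seq1.
Qed.

End FreeEval.
End FreeAlg.

Definition sgn (e : bool) : int := if e then 1 else - 1.

(* [ordS] is the cyclic successor.  For n = 1 both neighbours of a vertex
   coincide, giving the entries -2. *)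
Definition cartan (n : nat) (i j : 'I_n.+1) : int :=
  2 * (i == j)%:R - (j == ordS i)%:R - (i == ordS j)%:R.

Section QNumbers.
Variables (F : fieldType) (q : F).

Definition qint (m : int) : F := (q ^ m - q ^ (- m)) / (q - q^-1).
Definition qfact (m : nat) : F := \prod_(1 <= k < m.+1) qint k%:Z.
Definition qbin (m k : nat) : F := qfact m / (qfact k * qfact (m - k)).

End QNumbers.

Definition qcomm (F : fieldType) (A : algType F) (v : F) (a b : A) : A :=
  a * b - v *: (b * a).

(* The coefficient of z^m in exp(\sum_(r >= 0) c r * z^(r+1)); the terms with
   k > m or r >= m do not contribute to it. *)
Definition expCoef (F : fieldType) (A : algType F) (c : nat -> A) (m : nat) : A :=
  \sum_(k < m.+1) (k`!%:R : F)^-1 *: (('X * \poly_(r < m) c r) ^+ k)`_m.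

Definition nzint := {r : int | r != 0}.
Definition nzPos (r : nat) : nzint := exist _ (Posz r.+1) isT.
Definition nzNeg (r : nat) : nzint := exist _ (Negz r) isT.

(* In both types of generators a boolean stands for a sign, true being +. *)
Inductive torGen (n : nat) :=
| TorX of bool & 'I_n.+1 & int
| TorA of 'I_n.+1 & nzint
| TorK of bool & 'I_n.+1
| TorGammaHalf of bool
| TorD1 of bool
| TorD2 of bool.

HB.instance Definition _ n := gen_eqMixin (torGen n).
HB.instance Definition _ n := gen_choiceMixin (torGen n).

Section ToroidalRelations.
Variables (F : fieldType) (q : F) (n : nat) (A : algType F).
Variable g : torGen n -> A.
Implicit Types (i j : 'I_n.+1) (e b : bool) (k l : int) (r s : nzint).

Local Notation X e i k := (g (TorX e i k)).
Local Notation a i r := (g (TorA i r)).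
Local Notation K b i := (g (@TorK n b i)).
Local Notation Gh b := (g (@TorGammaHalf n b)).
Local Notation D1 b := (g (@TorD1 n b)).
Local Notation D2 b := (g (@TorD2 n b)).

(* gamma^(k/2); [Gh true] and [Gh false] are gamma^(1/2) and gamma^(-1/2). *)
Definition torGamma2 (k : int) : A := Gh (0 <= k) ^+ `|k|%N.

Definition torPhi i (m : int) : A :=
  if 0 <= m then
    K true i * expCoef (fun p => (q - q^-1) *: a i (nzPos p)) `|m|%N
  else 0.

Definition torVarphi i (m : int) : A :=
  if m <= 0 then
    K false i * expCoef (fun p => - (q - q^-1) *: a i (nzNeg p)) `|m|%N
  else 0.

Definition torSerre e i j (N : nat) (m : 'I_N -> int) (l : int) : A :=
  \sum_(w : 'S_N) \sum_(k < N.+1)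
    ((-1) ^+ k * qbin q N k) *:
      ((\prod_(t < N | (t < k)%N) X e i (m (w t))) * X e j l *
       (\prod_(t < N | (k <= t)%N) X e i (m (w t)))).

(* The defining relations, for a family [g] of elements of an algebra.  The
   order of the q-Serre relation is 1 - cartan i j, positive for i != j. *)
Inductive torRel : A -> A -> Prop :=
| torR_KV b i : torRel (K b i * K (~~ b) i) 1
| torR_GV b : torRel (Gh b * Gh (~~ b)) 1
| torR_D1V b : torRel (D1 b * D1 (~~ b)) 1
| torR_D2V b : torRel (D2 b * D2 (~~ b)) 1
| torR_Gcentral b h : torRel (Gh b * g h) (g h * Gh b)
| torR_KK b b' i j : torRel (K b i * K b' j) (K b' j * K b i)
| torR_KD1 b b' i : torRel (K b i * D1 b') (D1 b' * K b i)
| torR_KD2 b b' i : torRel (K b i * D2 b') (D2 b' * K b i)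
| torR_D1D2 b b' : torRel (D1 b * D2 b') (D2 b' * D1 b)
| torR_Ka b i j r : torRel (K b i * a j r) (a j r * K b i)
| torR_KX e i j k :
    torRel (K true i * X e j k * K false i)
           (q ^ (sgn e * cartan i j) *: X e j k)
| torR_D1a i r :
    torRel (D1 true * a i r * D1 false) (q ^ (val r) *: a i r)
| torR_D1X e i k :
    torRel (D1 true * X e i k * D1 false) (q ^ k *: X e i k)
| torR_D2a i r :
    torRel (D2 true * a i r * D2 false) (a i r)
| torR_D2X e i k :
    torRel (D2 true * X e i k * D2 false)
           (q ^ (sgn e * (i == ord0)%:R) *: X e i k)
| torR_aa i j r s :
    torRel (qcomm 1 (a i r) (a j s))
           (((val r + val s == 0)%:R * (qint q (val r * cartan i j) / (val r)%:~R)
               / (q - q^-1)) *: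
              (torGamma2 (2 * val r) - torGamma2 (- (2 * val r))))
| torR_aX e i j r k :
    torRel (qcomm 1 (a i r) (X e j k))
           (((sgn e)%:~R * (qint q (val r * cartan i j) / (val r)%:~R)) *:
              (torGamma2 (- (sgn e * `|val r|)) * X e j (val r + k)))
| torR_XX e i j k l :
    torRel (qcomm (q ^ (sgn e * cartan i j)) (X e i (k + 1)) (X e j l))
           (- qcomm (q ^ (sgn e * cartan i j)) (X e j (l + 1)) (X e i k))
| torR_XpXm i j k k' :
    torRel (qcomm 1 (X true i k) (X false j k'))
           (((i == j)%:R / (q - q^-1)) *:
              (torGamma2 (k - k') * torPhi i (k + k')
               - torGamma2 (k' - k) * torVarphi i (k + k')))
| torR_Serre e i j (m : 'I_(`|1 - cartan i j|%N) -> int) l :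
    i != j -> torRel (torSerre e i j m l) 0.

End ToroidalRelations.

Section ToroidalAlgebra.
Variables (F : fieldType) (q : F) (n : nat).

(* The character killing all x_i(k) and a_i(r) and sending the other generators
   to 1 shows that the ideal of relations is proper. *)
Definition torCounit (h : torGen n) : F :=
  match h with TorX _ _ _ => 0 | TorA _ _ => 0 | _ => 1 end.

Section Counit.
Variables (A : algType F) (g : torGen n -> A) (ev : {lrmorphism A -> F | *%R}).
Hypothesis evg : forall h, ev (g h) = torCounit h.

Lemma ev_expCoef (c : nat -> A) (m : nat) :
  (forall p, ev (c p) = 0) -> ev (expCoef c m) = (m == 0%N)%:R.
Proof.
move=> c0; rewrite /expCoef rmorph_sum /= (bigD1 ord0) //= big1 => [|k k0].
  by rewrite addr0 expr0 coef1 linearZ /= rmorph_nat invr1 mul1r.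
rewrite linearZ /= -coef_map rmorphXn /= rmorphM /=.
have -> : map_poly ev (\poly_(r < m) c r) = 0.
  apply/polyP=> d; rewrite coef_map coef_poly coef0.
  by case: ifP => _; [apply: c0 | apply: rmorph0].
by rewrite mulr0 expr0n (negPf (k0 : (k : nat) != 0%N)) coef0 mulr0.
Qed.

Lemma torRel_counit (u v : A) : torRel q g u v -> ev u = ev v.
Proof.
have evC (x y : A) : ev (x * y) = ev (y * x).
  by rewrite !rmorphM mulrC.
have evG k : ev (torGamma2 g k) = 1 by rewrite rmorphXn /= evg expr1n.
have evcm (z : F) (x y : A) : ev x = 0 \/ ev y = 0 -> ev (qcomm z x y) = 0.
  move=> h; rewrite /qcomm rmorphB /= linearZ /= !rmorphM /=.
  by case: h => ->; rewrite ?(mul0r, mulr0, subrr).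
have evphi i m : ev (torPhi q g i m) = (m == 0)%:R.
  rewrite /torPhi; case: m => m; last by rewrite rmorph0.
  rewrite rmorphM /= evg mul1r ev_expCoef // => r0.
  by rewrite linearZ /= evg mulr0.
have evvarphi i m : ev (torVarphi q g i m) = (m == 0)%:R.
  rewrite /torVarphi; case: m => [[|m]|m]; rewrite ?rmorph0 //;
    rewrite rmorphM /= evg mul1r ev_expCoef // => r0;
    by rewrite linearZ /= evg mulr0.
case=> [b i|b|b|b|b h|b b' i j|b b' i|b b' i|b b'|b i j s|e i j k
       |i s|e i k|i s|e i k|i j s t|e i j s k|e i j k m|i j k k'|e i j m k ij].
- by rewrite rmorphM rmorph1 /= !evg mulr1.
- by rewrite rmorphM rmorph1 /= !evg mulr1.
- by rewrite rmorphM rmorph1 /= !evg mulr1.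
- by rewrite rmorphM rmorph1 /= !evg mulr1.
- exact: evC.
- exact: evC.
- exact: evC.
- exact: evC.
- exact: evC.
- exact: evC.
- by rewrite !rmorphM linearZ /= !evg !(mul0r, mulr0).
- by rewrite !rmorphM linearZ /= !evg !(mul0r, mulr0).
- by rewrite !rmorphM linearZ /= !evg !(mul0r, mulr0).
- by rewrite !rmorphM /= !evg !(mul0r, mulr0).
- by rewrite !rmorphM linearZ /= !evg !(mul0r, mulr0).
- rewrite evcm ?evg; last by left.
  by rewrite linearZ /= rmorphB /= !evG subrr mulr0.
- rewrite evcm ?evg; last by left.
  by rewrite linearZ /= rmorphM /= evg !mulr0.
- by rewrite rmorphN /= !evcm ?evg ?oppr0 //; left.
- rewrite evcm ?evg; last by left.
  by rewrite linearZ /= rmorphB /= !rmorphM /= !evG evphi evvarphi subrr mulr0.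
- rewrite rmorph0 /torSerre rmorph_sum /= big1 // => w _.
  rewrite rmorph_sum /= big1 // => t _.
  by rewrite linearZ /= !rmorphM /= evg !(mul0r, mulr0).
Qed.

End Counit.

Lemma torRel_proper : ~ idealGen (torRel q (@gen F (torGen n))) 1.
Proof.
have [ev evg] := freeEval_exists torCounit.
exact: (idealGen_proper (torRel_counit evg)).
Qed.

(* U_q(sl_{n+1}, tor) *)
Definition torAlg : algType F := quotAlg (genIdeal torRel_proper).

Definition torElt (h : torGen n) : torAlg :=
  quotClass (genIdeal torRel_proper) (gen F h).

End ToroidalAlgebra.

(* [U0X e i] is x_i^e(0) and [U0Y e] is x_0^e(-e). *)
Inductive u0Gen (n : nat) :=
| U0X of bool & 'I_n.+1
| U0Y of bool
| U0K of bool & 'I_n.+1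
| U0GammaHalf of bool
| U0D1 of bool
| U0D2 of bool.

HB.instance Definition _ n := gen_eqMixin (u0Gen n).
HB.instance Definition _ n := gen_choiceMixin (u0Gen n).

Section U0Relations.
Variables (F : fieldType) (q : F) (n : nat) (A : algType F).
Variable g : u0Gen n -> A.
Implicit Types (i j : 'I_n.+1) (e b : bool).

Local Notation x e i := (g (U0X e i)).
Local Notation y e := (g (@U0Y n e)).
Local Notation K b i := (g (@U0K n b i)).
Local Notation Gh b := (g (@U0GammaHalf n b)).
Local Notation D1 b := (g (@U0D1 n b)).
Local Notation D2 b := (g (@U0D2 n b)).
Local Notation "[2]" := (qint q 2).

Inductive u0Rel : A -> A -> Prop :=
| u0R_KV b i : u0Rel (K b i * K (~~ b) i) 1
| u0R_GV b : u0Rel (Gh b * Gh (~~ b)) 1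
| u0R_D1V b : u0Rel (D1 b * D1 (~~ b)) 1
| u0R_D2V b : u0Rel (D2 b * D2 (~~ b)) 1
| u0R_Gcentral b h : u0Rel (Gh b * g h) (g h * Gh b)
| u0R_KK b b' i j : u0Rel (K b i * K b' j) (K b' j * K b i)
| u0R_KD1 b b' i : u0Rel (K b i * D1 b') (D1 b' * K b i)
| u0R_KD2 b b' i : u0Rel (K b i * D2 b') (D2 b' * K b i)
| u0R_D1D2 b b' : u0Rel (D1 b * D2 b') (D2 b' * D1 b)
| u0R_Kx e i j :
    u0Rel (K true i * x e j * K false i) (q ^ (sgn e * cartan i j) *: x e j)
| u0R_Ky e i :
    u0Rel (K true i * y e * K false i) (q ^ (sgn e * cartan i ord0) *: y e)
| u0R_D1x e i : u0Rel (D1 true * x e i * D1 false) (x e i)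
| u0R_D1y e : u0Rel (D1 true * y e * D1 false) (q ^ (- sgn e) *: y e)
| u0R_D2x e i :
    u0Rel (D2 true * x e i * D2 false)
          (q ^ (sgn e * (i == ord0)%:R) *: x e i)
| u0R_D2y e : u0Rel (D2 true * y e * D2 false) (q ^ sgn e *: y e)
| u0R_yx0 e : u0Rel (qcomm (q ^ (-2)) (y e) (x e ord0)) 0
| u0R_xpxm i j :
    u0Rel (qcomm 1 (x true i) (x false j))
          (((i == j)%:R / (q - q^-1)) *: (K true i - K false i))
| u0R_ypym :
    u0Rel (qcomm 1 (y true) (y false))
          ((q - q^-1)^-1 *:
             (Gh false ^+ 2 * K true ord0 - Gh true ^+ 2 * K false ord0))
| u0R_xy e i : i != ord0 -> u0Rel (qcomm 1 (x (~~ e) i) (y e)) 0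
| u0R_xx e i j : cartan i j = 0 -> u0Rel (qcomm 1 (x e i) (x e j)) 0
| u0R_yx e j : cartan ord0 j = 0 -> u0Rel (qcomm 1 (y e) (x e j)) 0
| u0R_Serre_xx e i j : cartan i j = -1 ->
    u0Rel (x e i ^+ 2 * x e j - [2] *: (x e i * x e j * x e i)
           + x e j * x e i ^+ 2) 0
| u0R_Serre_xy e j : cartan ord0 j = -1 ->
    u0Rel (x e j ^+ 2 * y e - [2] *: (x e j * y e * x e j)
           + y e * x e j ^+ 2) 0
| u0R_Serre_yxx e j : cartan ord0 j = -1 ->
    u0Rel (y e * x e ord0 * x e j - [2] *: (y e * x e j * x e ord0)
           + x e j * y e * x e ord0
           + x e ord0 * y e * x e j - [2] *: (x e ord0 * x e j * y e)
           + x e j * x e ord0 * y e) 0.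

End U0Relations.

Section U0Algebra.
Variables (F : fieldType) (q : F) (n : nat).

Definition u0Counit (h : u0Gen n) : F :=
  match h with U0X _ _ => 0 | U0Y _ => 0 | _ => 1 end.

Lemma u0Rel_counit (A : algType F) (g : u0Gen n -> A)
    (ev : {lrmorphism A -> F | *%R}) (u v : A) :
  (forall h, ev (g h) = u0Counit h) -> u0Rel q g u v -> ev u = ev v.
Proof.
move=> evg; have evZ c x : ev (c *: x) = c * ev x by rewrite linearZ.
have evM x y : ev (x * y) = ev x * ev y by rewrite rmorphM.
have evD x y : ev (x + y) = ev x + ev y by rewrite rmorphD.
have evN x : ev (- x) = - ev x by rewrite rmorphN.
have evX x : ev (x ^+ 2) = ev x * ev x by rewrite rmorphXn.
have ev0 : ev 0 = 0 by rewrite rmorph0.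
have ev1 : ev 1 = 1 by rewrite rmorph1.
have evC x y : ev (x * y) = ev (y * x) by rewrite !evM mulrC.
have E := (evD, evN, evZ, evX, evM, ev0, ev1, evg).
by case=> *; first [exact: evC
  | rewrite /qcomm !E /= ?(mulr0, mul0r, mulr1, subrr, addr0, oppr0)].
Qed.

Lemma u0Rel_proper : ~ idealGen (u0Rel q (@gen F (u0Gen n))) 1.
Proof.
have [ev evg] := freeEval_exists u0Counit.
exact: (idealGen_proper (fun l r => u0Rel_counit evg)).
Qed.

Definition u0Alg : algType F := quotAlg (genIdeal u0Rel_proper).

Definition u0Elt (h : u0Gen n) : u0Alg :=
  quotClass (genIdeal u0Rel_proper) (gen F h).

End U0Algebra.

(* The generator of the toroidal algebra denoted by the same symbol. *)
Definition u0ToTor (n : nat) (g : u0Gen n) : torGen n :=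
  match g with
  | U0X e i => TorX e i 0
  | U0Y e => TorX e ord0 (- sgn e)
  | U0K b i => TorK b i
  | U0GammaHalf b => TorGammaHalf n b
  | U0D1 b => TorD1 n b
  | U0D2 b => TorD2 n b
  end.

(* C(q), with C the complex numbers over the reals R. *)
Definition Cq (R : realType) : fieldType := {fraction {poly R[i]}}.
Definition qvar (R : realType) : Cq R := FracField.tofrac 'X.

(* Main.v *)
Require Import Defs.
From HB Require Import structures.
From mathcomp Require Import all_boot all_order all_algebra.
From mathcomp Require Import complex boolp reals.
From mathcomp Require Import perm finmap monalg zify.

Set Implicit Arguments.
Unset Strict Implicit.
Unset Printing Implicit Defensive.

Import Order.TTheory GRing.Theory Num.Theory.
Local Open Scope ring_scope.

(* The relations of the finite presentation are instances of toroidal ones, up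
   to a factor 2 coming from symmetrization.  For surjectivity, [x_0^+(-1),
   x_0^-(0)] and [x_0^+(0), x_0^-(1)] yield a_0(-1) and a_0(1); bracketing with
   a_i(1) and a_i(-1) shifts the degree of x_j(k) whenever a_ij != 0, so all
   x_0(k) are obtained and, going around the cycle of the Dynkin diagram, all
   x_j(k).  The brackets [x_i^+(k), x_i^-(l)] then give the coefficients of the
   exponential series, from which the a_i(r) are extracted recursively. *)

(** * Universal property of free algebras and of presented algebras *)

Section FreeAlgLift.
Variables (F : fieldType) (G : choiceType) (A : algType F) (h : G -> A).

Definition monomLift (m : {fmonom G}) : A := \prod_(g <- (m : seq G)) h g.

Lemma monomLift_mmorphism : mmorphism monomLift.
Proof.
split=> [x y|]; rewrite /monomLift; first by rewrite fmM big_cat.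
by rewrite fm1 big_nil.
Qed.

HB.instance Definition _ :=
  monalg.isMultiplicative.Build {fmonom G} A monomLift monomLift_mmorphism.

(** Coefficients enter through [in_alg A], which is central, so [A] need not be commutative. *)
Definition freeAlgLift : freeAlg F G -> A := mmap (in_alg A) monomLift.

HB.instance Definition _ := GRing.Additive.on freeAlgLift.

Lemma freeAlgLift_monoid_morphism : monoid_morphism freeAlgLift.
Proof.
have [] := @commr_mmap_is_multiplicative _ _ _ (in_alg A) monomLift.
  by move=> g m m'; rewrite /GRing.comm /= mulr_algl mulr_algr.
by split.
Qed.

HB.instance Definition _ :=
  GRing.isMonoidMorphism.Build (freeAlg F G) A freeAlgLift
    freeAlgLift_monoid_morphism.

Lemma freeAlgLift_scalable : scalable freeAlgLift.
Proof. by move=> c x; rewrite /freeAlgLift mmapZ /= mulr_algl. Qed.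

HB.instance Definition _ :=
  GRing.isScalable.Build F (freeAlg F G) A *:%R freeAlgLift
    freeAlgLift_scalable.

Lemma freeAlgLift_gen g : freeAlgLift (gen F g) = h g.
Proof.
by rewrite /freeAlgLift mmapU /= scale1r mul1r /monomLift fmU big_seq1.
Qed.

End FreeAlgLift.

Lemma freeAlg_monomE (F : fieldType) (G : choiceType) (c : F) (m : {fmonom G}) :
  << c *g m >> = c *: (\prod_(g <- (m : seq G)) gen F g) :> freeAlg F G.
Proof.
have -> : << c *g m >> = c *: << m >> :> freeAlg F G.
  by apply/malgP=> k; rewrite mcoeffZ !mcoeffU mulrnAr mulr1.
congr (_ *: _); case: m => s /=; elim: s => [|g s IHs].
  by rewrite big_nil; congr << _ >>; apply: val_inj; rewrite /= fm1.
rewrite big_cons -IHs [RHS]fgmulUU mulr1; congr << _ >>.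
by apply: val_inj; rewrite /= fmM fmU.
Qed.

(** The map is evaluated on chosen representatives: two representatives of a class differ by an
    element of [J], where [f] vanishes, so all structure passes through [fJE]. *)
Lemma quotAlg_lift (F : fieldType) (A B : algType F) (J : twoSidedIdeal A)
    (f : {lrmorphism A -> B}) :
  (forall x, x \in J -> f x = 0) ->
  exists fJ : {lrmorphism quotAlg J -> B}, forall x, fJ (quotClass J x) = f x.
Proof.
move=> f0; pose fJ (x : quotAlg J) := f (quotRepr x).
have fJE x : fJ (quotClass J x) = f x.
  apply/eqP; rewrite -subr_eq0 /fJ -(rmorphB f).
  by apply/eqP/f0/quotClassP/quotReprK.
have fJB : zmod_morphism fJ.
  move=> x y; rewrite -[x]quotReprK -[y]quotReprK.
  by rewrite -rmorphB !fJE rmorphB.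
have fJM : monoid_morphism fJ.
  split=> [|x y]; first by rewrite -(rmorph1 (quotClass J)) fJE rmorph1.
  by rewrite -[x]quotReprK -[y]quotReprK -rmorphM !fJE rmorphM.
have fJZ : scalable fJ.
  by move=> c x; rewrite -[x]quotReprK -linearZ !fJE linearZ.
pose addM := GRing.isZmodMorphism.Build _ _ fJ fJB.
pose mulM := GRing.isMonoidMorphism.Build _ _ fJ fJM.
pose scaM := GRing.isScalable.Build F _ _ *:%R fJ fJZ.
pose fL : {lrmorphism quotAlg J -> B} :=
  HB.pack fJ addM mulM scaM.
by exists fL.
Qed.

(** The inverse sends [y] to the class of a preimage picked by choice; two preimages of [y] differ
    by an element of the kernel. *)
Lemma quotAlg_ker_iso (F : fieldType) (A B : algType F)
    (f : {lrmorphism A -> B}) : (forall y, exists x, f x = y) ->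
  exists fJ : {lrmorphism quotAlg (kerIdeal f) -> B},
    bijective fJ /\ forall x, fJ (quotClass (kerIdeal f) x) = f x.
Proof.
move=> f_surj; have [x /eqP //|fJ fJE] := @quotAlg_lift _ _ _ (kerIdeal f) f.
exists fJ; split=> //; have [g gK] := choice f_surj.
exists (fun y => quotClass (kerIdeal f) (g y)) => [x|y]; last by rewrite fJE.
rewrite -[x in RHS]quotReprK -[x in fJ x]quotReprK fJE; apply/quotClassP.
by rewrite /in_mem /= /kerIdeal rmorphB /= gK subrr.
Qed.

Lemma idealGen_ker (A B : nzRingType) (f : {rmorphism A -> B})
    (rel : A -> A -> Prop) :
  (forall l r, rel l r -> f l = f r) -> forall x, idealGen rel x -> f x = 0.
Proof.
move=> f_rel x; elim=> [l r /f_rel e||u v _ fu _ fv|a u _ fu|a u _ fu].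
- by rewrite rmorphB e subrr.
- exact: rmorph0.
- by rewrite rmorphD fu fv addr0.
- by rewrite rmorphM fu mulr0.
- by rewrite rmorphM fu mul0r.
Qed.

Section Presentation.
Variables (F : fieldType) (G : choiceType).
Variable rel : freeAlg F G -> freeAlg F G -> Prop.
Hypothesis rel_proper : ~ idealGen rel 1.
Local Notation J := (genIdeal rel_proper).

Lemma genIdeal_rel u v : rel u v -> quotClass J u = quotClass J v.
Proof. by move=> uv; apply/quotClassP/asboolP/idealGen_rel. Qed.

Lemma presented_lift (B : algType F) (h : G -> B) :
  (forall u v, rel u v -> freeAlgLift h u = freeAlgLift h v) ->
  exists f : {lrmorphism quotAlg J -> B},
    forall g, f (quotClass J (gen F g)) = h g.
Proof.
move=> h_rel; pose hL : {lrmorphism freeAlg F G -> B} := freeAlgLift h.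
have [x /asboolP|f fE] := @quotAlg_lift _ _ _ J hL.
  exact: (idealGen_ker h_rel).
by exists f => g; rewrite fE /= freeAlgLift_gen.
Qed.

(** Every class has a representative that is a linear combination of words in the generators. *)
Lemma presented_ind (P : quotAlg J -> Prop) :
  P 1 -> (forall x y, P x -> P y -> P (x + y)) ->
  (forall x y, P x -> P y -> P (x * y)) ->
  (forall c x, P x -> P (c *: x)) ->
  (forall g, P (quotClass J (gen F g))) -> forall x, P x.
Proof.
move=> P1 PD PM PZ Pgen x; rewrite -[x]quotReprK [quotRepr x]monalgE.
have P0 : P 0 by rewrite -(scale0r 1); apply: PZ.
rewrite raddf_sum; elim/big_ind: _ => // m _.
rewrite freeAlg_monomE /= (linearZ_LR (quotClass J)) /=; apply: PZ.
by rewrite rmorph_prod; elim/big_ind: _ => // g _; apply: Pgen.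
Qed.

End Presentation.

(** * Entries of the Cartan matrix, and q-numbers when q is not a root of unity *)

Section Cartan.
Variable n : nat.
Implicit Types i j : 'I_n.+1.

Lemma cartanC i j : cartan i j = cartan j i.
Proof. by rewrite /cartan eq_sym addrAC. Qed.

Lemma ordS_neq i : (1 <= n)%N -> ordS i != i.
Proof.
move=> n1; apply/eqP => /(congr1 val) /=; case: (ltnP i n) => [lt_in|le_ni].
  by rewrite modn_small ?ltnS //; lia.
have -> : i = n :> nat by have := ltn_ord i; lia.
by rewrite modnn; lia.
Qed.

Lemma cartan_ii i : (1 <= n)%N -> cartan i i = 2.
Proof.
by move=> /(ordS_neq i)/negPf nei; rewrite /cartan eqxx (eq_sym i) nei !subr0.
Qed.

(** The entry is -1, or -2 when n = 1. Its being nonzero is what carries generation from one vertex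
    of the cycle to the next. *)
Lemma cartan_ordS i : (1 <= n)%N -> cartan i (ordS i) != 0.
Proof.
move=> /(ordS_neq i)/negPf nei.
rewrite /cartan (eq_sym i (ordS i)) nei eqxx mulr0.
by case: (i == _).
Qed.

End Cartan.

Section QintNeq0.
Variables (F : fieldType) (q : F).
Hypotheses (q0 : q != 0) (q_nroot : forall m, (0 < m)%N -> q ^+ m != 1).

Lemma exprz_neq1 (m : int) : m != 0 -> q ^ m != 1.
Proof.
case: m => m m0; first by apply: q_nroot; lia.
by rewrite NegzE -invr_expz invr_eq1 q_nroot.
Qed.

(** Otherwise q^(2m) = 1. *)
Lemma exprz_subN_neq0 (m : int) : m != 0 -> q ^ m - q ^ (- m) != 0.
Proof.
move=> m0; rewrite subr_eq0; apply/eqP => e.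
have : q ^ (m + m) != 1 by apply: exprz_neq1; lia.
by rewrite expfzDr // {1}e -expfzDr // addNr expr0z eqxx.
Qed.

Lemma subrV_neq0 : q - q^-1 != 0.
Proof. exact: (@exprz_subN_neq0 1). Qed.

Lemma qint_neq0 (m : int) : m != 0 -> qint q m != 0.
Proof.
by move=> m0; rewrite mulf_neq0 ?invr_neq0 ?subrV_neq0 ?exprz_subN_neq0.
Qed.

Lemma qint1 : qint q 1 = 1.
Proof. by rewrite /qint divff ?subrV_neq0. Qed.

Lemma qfact_neq0 m : qfact q m != 0.
Proof.
rewrite /qfact prodf_seq_neq0; apply/allP => k; rewrite mem_index_iota /= => k1.
by apply: qint_neq0; lia.
Qed.

Lemma qbin0 m : qbin q m 0 = 1.
Proof. by rewrite /qbin subn0 {2}/qfact big_geq // mul1r divff ?qfact_neq0. Qed.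

Lemma qbinn m : qbin q m m = 1.
Proof.
by rewrite /qbin subnn {3}/qfact big_geq // mulr1 divff ?qfact_neq0.
Qed.

Lemma qbin21 : qbin q 2 1 = qint q 2.
Proof.
have f1 : qfact q 1 = 1 by rewrite /qfact big_nat1 qint1.
rewrite /qbin f1 mulr1 divr1 /qfact big_nat_recr //=.
by rewrite -/(qfact q 1) f1 mul1r.
Qed.

End QintNeq0.

(** * Transport of the relations along algebra morphisms *)

Section RelMorph.
Variables (F : fieldType) (q : F) (n : nat) (A B : algType F).
Variable f : {lrmorphism A -> B}.

Lemma lrmorphE :
  (f 0 = 0) * (f 1 = 1) * {morph f : x y / x + y} * {morph f : x / - x} *
  {morph f : x y / x * y} * (forall m, {morph f : x / x ^+ m}) *
  (forall c, {morph f : x / c *: x}).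
Proof.
exact: (rmorph0 f, rmorph1 f, rmorphD f, rmorphN f, rmorphM f,
        fun m => rmorphXn f m, fun c => @linearZ_LR _ _ _ _ f c).
Qed.

(** Turns a relation of the free algebra into one between elements of the target, as needed to check
    the hypothesis of [presented_lift]. *)
Lemma u0Rel_morph (g : u0Gen n -> A) (h : u0Gen n -> B) u v :
  (forall x, f (g x) = h x) -> u0Rel q g u v -> u0Rel q h (f u) (f v).
Proof.
by move=> fg; case=> *; rewrite /qcomm !(lrmorphE, fg); constructor.
Qed.

Lemma expCoef_morph (c : nat -> A) m :
  f (expCoef c m) = expCoef (fun p => f (c p)) m.
Proof.
rewrite /expCoef rmorph_sum; apply: eq_bigr => k _ /=; rewrite linearZ.
congr (_ *: _); rewrite /= -coef_map rmorphXn rmorphM /= map_polyX.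
congr (('X * _) ^+ _)`_ _; apply/polyP => d.
by rewrite coef_map !coef_poly; case: ifP => _ //=; rewrite rmorph0.
Qed.

(** Goes in the direction opposite to [u0Rel_morph]: a relation between classes of generators is
    lifted to the free algebra, where it belongs to the defining ideal. *)
Lemma torRel_lift (g : torGen n -> A) (h : torGen n -> B) u v :
  (forall x, f (g x) = h x) -> torRel q h u v ->
  exists u' v', [/\ torRel q g u' v', f u' = u & f v' = v].
Proof.
move=> fg.
have fgamma k : f (torGamma2 g k) = torGamma2 h k.
  by rewrite /torGamma2 rmorphXn /= fg.
have fphi i m : f (torPhi q g i m) = torPhi q h i m.
  rewrite /torPhi; case: ifP => _; last by rewrite rmorph0.
  rewrite rmorphM /= fg expCoef_morph; congr (_ * expCoef _ _).
  by apply: funext => p; rewrite linearZ /= fg.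
have fvarphi i m : f (torVarphi q g i m) = torVarphi q h i m.
  rewrite /torVarphi; case: ifP => _; last by rewrite rmorph0.
  rewrite rmorphM /= fg expCoef_morph; congr (_ * expCoef _ _).
  by apply: funext => p; rewrite linearZ /= fg.
have fserre e i j N (m : 'I_N -> int) l :
    f (torSerre q g e i j m l) = torSerre q h e i j m l.
  rewrite /torSerre rmorph_sum; apply: eq_bigr => w _ /=.
  rewrite rmorph_sum; apply: eq_bigr => k _ /=.
  rewrite linearZ !rmorphM !rmorph_prod /= fg.
  by congr (_ *: (_ * _ * _)); apply: eq_bigr => t _.
case=> [b i|b|b|b|b x|b b' i j|b b' i|b b' i|b b'|b i j r|e i j k|i r|e i k
  |i r|e i k|i j r s|e i j r k|e i j k l|i j k k'|e i j m l ij];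
[ move: (torR_KV q g b i) | move: (torR_GV q g b) | move: (torR_D1V q g b)
| move: (torR_D2V q g b) | move: (torR_Gcentral q g b x)
| move: (torR_KK q g b b' i j) | move: (torR_KD1 q g b b' i)
| move: (torR_KD2 q g b b' i) | move: (torR_D1D2 q g b b')
| move: (torR_Ka q g b i j r) | move: (torR_KX q g e i j k)
| move: (torR_D1a q g i r) | move: (torR_D1X q g e i k)
| move: (torR_D2a q g i r) | move: (torR_D2X q g e i k)
| move: (torR_aa q g i j r s) | move: (torR_aX q g e i j r k)
| move: (torR_XX q g e i j k l) | move: (torR_XpXm q g i j k k')
| move: (torR_Serre q g e m l ij) ] => gr;
by do 2!eexists; split; first exact: gr;
  rewrite /qcomm !(fgamma, fphi, fvarphi, fserre, lrmorphE, fg).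
Qed.

End RelMorph.

(** * The relations of the finite presentation hold in the toroidal algebra *)

Lemma big_perm1 (V : zmodType) (f : 'S_1 -> V) :
  \sum_w f w = f (1%g : {perm _}).
Proof.
rewrite (bigD1 (1%g : 'S_1)) //= big1 ?addr0 // => w /eqP[].
by apply/permP => x; rewrite !ord1.
Qed.

Lemma big_perm2 (V : zmodType) (f : 'S_2 -> V) :
  \sum_w f w = f (1%g : {perm _}) + f (tperm ord0 ord_max).
Proof.
have ne : tperm ord0 ord_max != 1%g :> 'S_2.
  by apply/eqP => /permP /(_ ord0); rewrite tpermL perm1.
(* By counting: the identity and the transposition are two distinct elements of a group of order
   2. *)
have e2 : [set: 'S_2] = [set (1%g : 'S_2); tperm ord0 ord_max].
  by apply/esym/eqP; rewrite eqEcard subsetT cardsT card_Sn cards2 eq_sym ne.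
rewrite -[RHS]addr0 (bigD1 (1%g : 'S_2)) //=.
rewrite (bigD1 (tperm ord0 ord_max)) //= addrA; congr (_ + _).
rewrite big1 // => w /andP[w1 wt].
by have := in_setT w; rewrite e2 !inE (negPf w1) (negPf wt).
Qed.

Lemma prod_cond_ord1 (B : nzRingType) (P : pred 'I_1) (f : 'I_1 -> B) :
  \prod_(t < 1 | P t) f t = if P ord0 then f ord0 else 1.
Proof. by rewrite big_mkcond big_ord1. Qed.

Lemma prod_cond_ord2 (B : nzRingType) (P : pred 'I_2) (f : 'I_2 -> B) :
  \prod_(t < 2 | P t) f t =
  (if P ord0 then f ord0 else 1) * (if P ord_max then f ord_max else 1).
Proof.
rewrite big_mkcond big_ord_recl big_ord1.
by rewrite (_ : lift ord0 ord0 = ord_max) //; apply: val_inj.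
Qed.

Section Toroidal.
Variables (F : fieldType) (q : F) (n : nat) (A : algType F).
Variable g : torGen n -> A.
Hypotheses (n_gt0 : (1 <= n)%N) (q0 : q != 0).
Hypotheses (two0 : 2 != 0 :> F) (q_nroot : forall m, (0 < m)%N -> q ^+ m != 1).
Hypothesis g_rel : forall u v, torRel q g u v -> u = v.
Implicit Types (i j : 'I_n.+1) (e b : bool).

Local Notation X e i k := (g (TorX e i k)).

(** Here N = 1, and the two terms of the Serre sum form a commutator. *)
Lemma torSerre1 e i j a l : cartan i j = 0 -> qcomm 1 (X e i a) (X e j l) = 0.
Proof.
move=> cij; have ij : i != j.
  by apply: contra_eq_neq cij => ->; rewrite cartan_ii.
have := g_rel (torR_Serre q g e (fun _ => a) l ij); rewrite cij /torSerre.
rewrite big_perm1 !big_ord_recl !big_ord0 !prod_cond_ord1 /= qbin0 // qbinn //.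
rewrite ?big_ord0 !(mulr1, mul1r, expr0, expr1, scale1r, addr0, scaleN1r).
by move=> /eqP; rewrite subr_eq0 => /eqP e0; rewrite /qcomm scale1r e0 subrr.
Qed.

(** Here N = 2, and symmetrization adds the two orders of the degrees. Taking a = c gives twice the
    q-Serre relation; a = -e, c = 0 gives the mixed relation (xi). *)
Lemma torSerre2 e i j a c l : cartan i j = -1 ->
  let p x y := X e i x * X e i y * X e j l
    - qint q 2 *: (X e i x * X e j l * X e i y) + X e j l * X e i x * X e i y in
  p a c + p c a = 0.
Proof.
move=> cij; have ij : i != j.
  by apply: contra_eq_neq cij => ->; rewrite cartan_ii.
have := g_rel (torR_Serre q g e
  (fun t => if t == 0%N :> nat then a else c) l ij).
rewrite cij /torSerre.
rewrite big_perm2 !big_ord_recl !big_ord0 !prod_cond_ord2 /= /bump /=.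
rewrite qbin0 // qbinn // qbin21 // !perm1 tpermL.
rewrite (_ : lift ord0 ord0 = ord_max) ?tpermR; last exact: val_inj.
rewrite ?big_ord0 !(mulr1, mul1r, expr0, expr1, scale1r, addr0, scaleN1r, sqrrN,
  expr1n) /=.
rewrite !mulN1r !scaleNr => e0; rewrite -[RHS]e0.
by congr (_ + _); rewrite -!mulrA addrC; congr (_ + _); apply: addrC.
Qed.

Lemma expCoef0 (c : nat -> A) : expCoef c 0 = 1.
Proof. by rewrite /expCoef big_ord1 expr0 coef1 invr1 scale1r. Qed.

Lemma torPhi0 i : torPhi q g i 0 = g (TorK true i).
Proof. by rewrite /torPhi expCoef0 mulr1. Qed.

Lemma torVarphi0 i : torVarphi q g i 0 = g (TorK false i).
Proof. by rewrite /torVarphi expCoef0 mulr1. Qed.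

Lemma qcomm1C (x y : A) : qcomm 1 x y = - qcomm 1 y x.
Proof. by rewrite /qcomm !scale1r opprB. Qed.

Lemma eq_oppr0 (w : A) : w = - w -> w = 0.
Proof.
move=> ww; have /eqP : 2 *: w = 0 by rewrite scaler_nat mulr2n {1}ww addNr.
by rewrite scaler_eq0 (negPf two0) => /eqP.
Qed.

(** Relation (6) with i = j and k = l reads w = -w. *)
Lemma torX_qcomm e i k :
  qcomm (q ^ (sgn e * 2)) (X e i (k + 1)) (X e i k) = 0.
Proof.
by have := g_rel (torR_XX q g e i i k k); rewrite cartan_ii // => /eq_oppr0.
Qed.

Lemma commX0 e : qcomm (q ^ (-2)) (X e ord0 (- sgn e)) (X e ord0 0) = 0.
Proof.
case: e; last exact: (torX_qcomm false ord0 0).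
(* For the sign +, the relation reads x(0)x(-1) = q^2 x(-1)x(0), with the factors in the other
   order; multiplying by q^(-2) gives the claim. *)
have /eqP := torX_qcomm true ord0 (-1).
rewrite subr_eq0 => /eqP e0; rewrite /qcomm e0 scalerA -expfzDr //.
by rewrite expr0z scale1r subrr.
Qed.

Lemma u0Rel_tor u v : u0Rel q (g \o @u0ToTor n) u v -> u = v.
Proof.
have half (w : A) : w + w = 0 -> w = 0.
  by move=> /eqP; rewrite addr_eq0 => /eqP /eq_oppr0.
have serre e i j a l : cartan i j = -1 ->
    X e i a ^+ 2 * X e j l - qint q 2 *: (X e i a * X e j l * X e i a)
      + X e j l * X e i a ^+ 2 = 0.
  move=> cij; have /half := torSerre2 e a a l cij.
  by rewrite expr2 [X e j l * (_ * _)]mulrA.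
case=> [b i|b|b|b|b x|b b' i j|b b' i|b b' i|b b'|e i j|e i|e i|e|e i|e|e
  |i j||e i i0|e i j cij|e j cij|e i j cij|e j cij|e j cij] /=.
- exact/g_rel/torR_KV.
- exact/g_rel/torR_GV.
- exact/g_rel/torR_D1V.
- exact/g_rel/torR_D2V.
- exact/g_rel/torR_Gcentral.
- exact/g_rel/torR_KK.
- exact/g_rel/torR_KD1.
- exact/g_rel/torR_KD2.
- exact/g_rel/torR_D1D2.
- exact/g_rel/torR_KX.
- exact/g_rel/torR_KX.
- by rewrite (g_rel (torR_D1X q g e i 0)) expr0z scale1r.
- exact/g_rel/torR_D1X.
- exact/g_rel/torR_D2X.
- by rewrite (g_rel (torR_D2X q g e ord0 _)) eqxx mulr1.
- exact: commX0.
- rewrite (g_rel (torR_XpXm q g i j 0 0)) /torGamma2 !mul1r.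
  by rewrite torPhi0 torVarphi0.
(* The total degree is 0, so the series contribute only K_0 and its inverse, while the difference of
   degrees produces the powers of gamma. *)
- rewrite (g_rel (torR_XpXm q g ord0 ord0 (-1) 1)) eqxx mul1r.
  by rewrite torPhi0 torVarphi0.
- have XX0 k k' j j' : j != j' -> qcomm 1 (X true j k) (X false j' k') = 0.
    move=> /negPf jj'.
    by rewrite (g_rel (torR_XpXm q g j j' k k')) jj' mul0r scale0r.
  case: e => /=; last exact: XX0.
  by rewrite eq_sym in i0; rewrite qcomm1C XX0 ?oppr0.
- exact: torSerre1.
- exact: torSerre1.
- exact: serre.
- by apply: serre; rewrite cartanC.
- by have /= := torSerre2 e (- sgn e) 0 0 cij; rewrite !addrA.
Qed.

End Toroidal.

(** * Generation: a predicate [P] closed under the algebra operations and containing the images of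
    the generators holds on all toroidal generators *)

Section Generation.
Variables (F : fieldType) (A : algType F) (P : A -> Prop).
Hypotheses (P1 : P 1) (PD : forall x y, P x -> P y -> P (x + y)).
Hypotheses (PM : forall x y, P x -> P y -> P (x * y)).
Hypothesis PZ : forall c x, P x -> P (c *: x).

Lemma gen0 : P 0. Proof. by rewrite -(scale0r 1); apply: PZ. Qed.

Lemma genN x : P x -> P (- x). Proof. by rewrite -scaleN1r; apply: PZ. Qed.

Lemma gen_sum I (r : seq I) (C : pred I) (f : I -> A) :
  (forall i, C i -> P (f i)) -> P (\sum_(i <- r | C i) f i).
Proof. by move=> Pf; elim/big_ind: _ => //; apply: gen0. Qed.

Lemma genZI c x : P (c *: x) -> c != 0 -> P x.
Proof. by move=> /(PZ c^-1) + c0; rewrite scalerA mulVf // scale1r. Qed.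

Lemma gen_qcomm v x y : P x -> P y -> P (qcomm v x y).
Proof. by move=> Px Py; apply/PD/genN/PZ; apply: PM. Qed.

Lemma gen_coef_exp (p : {poly A}) k d :
  (forall m, (m <= d)%N -> P p`_m) -> P (p ^+ k)`_d.
Proof.
elim: k d => [|k IHk] d Pp.
  by rewrite expr0 coef1; case: (d == _) => //; apply: gen0.
rewrite exprS coefM; apply: gen_sum => m _; apply: PM.
  by apply: Pp; rewrite -ltnS.
by apply: IHk => m' m'_le; apply: Pp; apply: leq_trans m'_le (leq_subr _ _).
Qed.

(* The coefficient of z^(m+1) in the exponential is c m plus a polynomial in
   c 0, ..., c (m - 1). *)
Lemma gen_expCoefI (c : nat -> A) m :
  (forall p, (p < m)%N -> P (c p)) -> P (expCoef c m.+1) -> P (c m).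
Proof.
(* The term k = 0 contributes nothing in degree m + 1, and the term k = 1 contributes exactly
   [c m]. *)
move=> Pc; rewrite /expCoef !big_ord_recl expr0 coef1 scaler0 add0r.
rewrite expr1 invr1 scale1r coefXM coef_poly ltnSn /=.
set s := \sum_(i < m) _ => Pcs; rewrite -[c m](addrK s); apply/PD/genN => //.
apply: gen_sum => k _; apply: PZ.
(* The variable is central, so it factors out to the power k, now at least 2; what remains are
   coefficients of index at most m + 1 - k, hence less than m. *)
rewrite exprMn_comm; last exact/commr_sym/commr_polyX.
rewrite coefXnM; case: ltnP => [_|k_le]; first exact: gen0.
apply: gen_coef_exp => p p_le; rewrite coef_poly.
case: ltnP => [_|_]; last exact: gen0.
by apply: Pc; move: p_le k_le; rewrite /bump /=; lia.
Qed.

Variables (q : F) (n : nat) (g : torGen n -> A).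
Hypotheses (n_gt0 : (1 <= n)%N) (q0 : q != 0).
Hypotheses (q_nroot : forall m, (0 < m)%N -> q ^+ m != 1).
Hypothesis g_rel : forall u v, torRel q g u v -> u = v.
Hypothesis Pg : forall u, P (g (@u0ToTor n u)).
Implicit Types (i j : 'I_n.+1) (e b : bool).

Local Notation X e i k := (g (TorX e i k)).
Local Notation K b i := (g (@TorK n b i)).
Local Notation Gh b := (g (@TorGammaHalf n b)).

Let PK b i : P (K b i). Proof. exact: (Pg (U0K b i)). Qed.
Let PGh b : P (Gh b). Proof. exact: (Pg (U0GammaHalf n b)). Qed.
Let PX e i : P (X e i 0). Proof. exact: (Pg (U0X e i)). Qed.
Let PY e : P (X e ord0 (- sgn e)). Proof. exact: (Pg (U0Y n e)). Qed.

Lemma gen_KI b i x : P (K b i * x) -> P x.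
Proof.
move=> /(PM (PK (~~ b) i)); rewrite mulrA.
by have := g_rel (torR_KV q g (~~ b) i); rewrite negbK => ->; rewrite mul1r.
Qed.

Lemma gen_gammaI k x : P (torGamma2 g k * x) -> P x.
Proof.
rewrite /torGamma2; elim: absz => [|m IHm]; first by rewrite mul1r.
rewrite exprS -mulrA => /(PM (PGh (~~ (0 <= k)))); rewrite mulrA.
have := g_rel (torR_GV q g (~~ (0 <= k))); rewrite negbK => ->.
by rewrite mul1r.
Qed.

(** In positive total degree the varphi term vanishes, so the bracket is phi up to a nonzero scalar
    and an invertible power of gamma. *)
Lemma gen_torPhi i k k' : 0 < k + k' ->
  P (X true i k) -> P (X false i k') -> P (torPhi q g i (k + k')).
Proof.
move=> kk' Pk Pk'; have := gen_qcomm 1 Pk Pk'.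
rewrite (g_rel (torR_XpXm q g i i k k')) eqxx => /genZI.
rewrite div1r invr_neq0 ?subrV_neq0 // => /(_ isT).
rewrite [torVarphi _ _ _ _]/torVarphi leNgt kk' /= mulr0 subr0.
exact: gen_gammaI.
Qed.

Lemma gen_torVarphi i k k' : k + k' < 0 ->
  P (X true i k) -> P (X false i k') -> P (torVarphi q g i (k + k')).
Proof.
move=> kk' Pk Pk'; have := gen_qcomm 1 Pk Pk'.
rewrite (g_rel (torR_XpXm q g i i k k')) eqxx => /genZI.
rewrite div1r invr_neq0 ?subrV_neq0 // => /(_ isT).
rewrite [torPhi _ _ _ _]/torPhi leNgt kk' /= mulr0 sub0r => /genN.
by rewrite opprK; apply: gen_gammaI.
Qed.

(** Note the offset: [nzPos m] is the degree m + 1. Once K_i is cancelled, the coefficient of the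
    exponential determines a_i(m + 1) from the lower ones. *)
Lemma gen_aPos i m : (forall p, (p < m)%N -> P (g (TorA i (nzPos p)))) ->
  P (torPhi q g i m.+1) -> P (g (TorA i (nzPos m))).
Proof.
move=> Pa; rewrite /torPhi /= => /gen_KI/gen_expCoefI Pc.
apply: (@genZI (q - q^-1)) (subrV_neq0 q0 q_nroot).
by apply: Pc => p /Pa; apply: PZ.
Qed.

Lemma gen_aNeg i m : (forall p, (p < m)%N -> P (g (TorA i (nzNeg p)))) ->
  P (torVarphi q g i (Negz m)) -> P (g (TorA i (nzNeg m))).
Proof.
move=> Pa; rewrite /torVarphi /= => /gen_KI/gen_expCoefI Pc.
apply: (@genZI (- (q - q^-1))); last by rewrite oppr_eq0 subrV_neq0.
by apply: Pc => p /Pa; apply: PZ.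
Qed.

(** By relation (5), the bracket of a_i(r) with x_j(k) is x_j(r + k) times a power of gamma and the
    scalar ±[r a_ij]/r. *)
Lemma gen_shift e i j r k : `|val r| = 1 -> cartan i j != 0 ->
  P (g (TorA i r)) -> P (X e j k) -> P (X e j (val r + k)).
Proof.
move=> r1 cij Pa Pk; have := gen_qcomm 1 Pa Pk.
rewrite (g_rel (torR_aX q g e i j r k)) => /genZI c0; apply/gen_gammaI/c0.
(* Since r = ±1, it stays nonzero in [F] in any characteristic. *)
have r_unit : (val r)%:~R != 0 :> F.
  have [->|->] : val r = 1 \/ val r = -1 by lia.
    by rewrite oner_eq0.
  by rewrite mulrN1z oppr_eq0 oner_eq0.
have rc : val r * cartan i j != 0 by rewrite mulf_neq0 ?(valP r).
have qrc := qint_neq0 q0 q_nroot rc.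
apply: mulf_neq0; last by rewrite mulf_neq0 // invr_neq0.
by case: (e); rewrite /= ?mulrN1z ?oppr_eq0 oner_eq0.
Qed.

Definition genNode j := forall e k, P (X e j k).

(** [nzPos 0] and [nzNeg 0] are the degrees 1 and -1, so induction upwards and downwards from x_j(0)
    reaches every degree. *)
Lemma genNode_cartan i j : cartan i j != 0 -> P (g (TorA i (nzPos 0))) ->
  P (g (TorA i (nzNeg 0))) -> genNode j.
Proof.
move=> cij Pp Pn e; case; elim=> [|k IHk].
- exact: PX.
- by have := @gen_shift e i j (nzPos 0) _ erefl cij Pp IHk.
- by have := @gen_shift e i j (nzNeg 0) _ erefl cij Pn (PX e j).
- have := @gen_shift e i j (nzNeg 0) _ erefl cij Pn IHk.
  by rewrite (_ : _ + _ = Negz k.+1) //; rewrite /=; lia.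
Qed.

(** Vertex 0 shifts itself, as a_00 = 2. In the generation argument, x_0^+(-1) and x_0^-(1) enter
    only here, to produce a_0(-1) and a_0(1). *)
Lemma genNode_ord0 : genNode ord0.
Proof.
apply: (@genNode_cartan ord0); first by rewrite cartan_ii.
  apply: gen_aPos => //.
  by apply: (@gen_torPhi ord0 0 1) => //; apply: (PY false).
apply: gen_aNeg => //.
by apply: (@gen_torVarphi ord0 (-1) 0) => //; apply: (PY true).
Qed.

Lemma genNode_a i r : genNode i -> P (g (TorA i r)).
Proof.
move=> Pi; case: r => -[] m m0.
  case: m m0 => // m m0.
  rewrite (_ : exist _ _ _ = nzPos m); last exact: val_inj.
  (* Strong induction on the degree, obtaining phi_i(m + 1) from the bracket of x_i^+(m + 1) and
     x_i^-(0). *)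
  elim/ltn_ind: m {m0} => m IHm; apply: gen_aPos => //.
  by rewrite -[Posz _]addr0; apply: gen_torPhi.
rewrite (_ : exist _ _ _ = nzNeg m); last exact: val_inj.
elim/ltn_ind: m {m0} => m IHm; apply: gen_aNeg => //.
by rewrite -[Negz _]addr0; apply: gen_torVarphi.
Qed.

Lemma genNode_all j : genNode j.
Proof.
case: j => m; elim: m => [|m IHm] m_lt.
  by rewrite (_ : Ordinal _ = ord0); [apply: genNode_ord0 | apply: val_inj].
have Pm := IHm (ltnW m_lt).
(* As m + 1 is at most n, the cyclic successor does not wrap around. *)
rewrite (_ : Ordinal m_lt = ordS (Ordinal (ltnW m_lt))); last first.
  by apply: val_inj; rewrite /= modn_small.
by apply: (genNode_cartan (cartan_ordS _ n_gt0)); apply: genNode_a.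
Qed.

Lemma gen_tor t : P (g t).
Proof.
case: t => [e i k|i r|b i|b|b|b].
- exact: genNode_all.
- exact/genNode_a/genNode_all.
- exact: (Pg (U0K b i)).
- exact: (Pg (U0GammaHalf n b)).
- exact: (Pg (U0D1 n b)).
- exact: (Pg (U0D2 n b)).
Qed.

End Generation.

(** * The epimorphism over a general field, then over C(q) *)

Lemma u0Alg_epi (F : fieldType) (q : F) (n : nat) :
  (1 <= n)%N -> q != 0 -> 2 != 0 :> F ->
  (forall m, (0 < m)%N -> q ^+ m != 1) ->
  exists pi : {lrmorphism u0Alg q n -> torAlg q n},
    (forall g, pi (u0Elt q g) = torElt q (u0ToTor g)) /\
    forall y, exists x, pi x = y.
Proof.
move=> n1 q0 two0 q_nroot.
have tor_rel u v : torRel q (@torElt F q n) u v -> u = v.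
  pose f : {lrmorphism _ -> torAlg q n} :=
    quotClass (genIdeal (@torRel_proper F q n)).
  move=> /(@torRel_lift _ _ _ _ _ f (@gen F (torGen n))) [] // u' [v'].
  by case=> /(genIdeal_rel (@torRel_proper F q n)) uv <- <-.
have [u v uv|pi piE] := @presented_lift _ _ _ (@u0Rel_proper F q n) (torAlg q n)
    (@torElt F q n \o @u0ToTor n).
  apply: (u0Rel_tor n1 q0 two0 q_nroot tor_rel).
  exact: (u0Rel_morph (freeAlgLift_gen _) uv).
exists pi; split=> //.
(* Surjectivity: the image of [pi] is a subalgebra, so it suffices that it contains the toroidal
   generators, which is [gen_tor] applied to membership in this image. *)
apply: presented_ind.
- by exists 1; rewrite rmorph1.
- by move=> _ _ [x <-] [y <-]; exists (x + y); rewrite rmorphD.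
- by move=> _ _ [x <-] [y <-]; exists (x * y); rewrite rmorphM.
- by move=> c _ [x <-]; exists (c *: x); rewrite linearZ.
apply: (@gen_tor _ _ (fun y => exists x, pi x = y) _ _ _ _ q _ (@torElt F q n))
  => //.
- by exists 1; rewrite rmorph1.
- by move=> _ _ [x <-] [y <-]; exists (x + y); rewrite rmorphD.
- by move=> _ _ [x <-] [y <-]; exists (x * y); rewrite rmorphM.
- by move=> c _ [x <-]; exists (c *: x); rewrite linearZ.
by move=> u; exists (u0Elt q u); apply: piE.
Qed.

Section FracX.
Variable R : realType.

Lemma qvar_neq0 : qvar R != 0.
Proof. by rewrite tofrac_eq0 polyX_eq0. Qed.

(** The polynomials X^m and 1 have different degrees. *)
Lemma qvar_not_root m : (0 < m)%N -> qvar R ^+ m != 1.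
Proof.
move=> m0; rewrite -tofracXn -tofrac1 tofrac_eq; apply/eqP.
move=> /(congr1 (fun p : {poly _} => size p)).
by rewrite size_polyXn size_poly1 => -[m_eq0]; rewrite m_eq0 in m0.
Qed.

Lemma Cq_two_neq0 : 2 != 0 :> Cq R.
Proof.
by rewrite -tofrac1 -tofracMn tofrac_eq0 -polyC1 -polyCMn polyC_eq0 pnatr_eq0.
Qed.

End FracX.

Theorem theorem4p2 (R : realType) (n : nat) (hn : (1 <= n)%N) :
  exists pi : {lrmorphism u0Alg (qvar R) n -> torAlg (qvar R) n},
    [/\ forall g : u0Gen n,
          pi (u0Elt (qvar R) g) = torElt (qvar R) (u0ToTor g),
        forall y : torAlg (qvar R) n, exists x : u0Alg (qvar R) n, pi x = y &
        exists f : {lrmorphism quotAlg (kerIdeal pi) -> torAlg (qvar R) n},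
          bijective f /\
          forall x : u0Alg (qvar R) n, f (quotClass (kerIdeal pi) x) = pi x].
Proof.
have [pi [piE pi_surj]] :=
  u0Alg_epi hn (qvar_neq0 R) (Cq_two_neq0 R) (@qvar_not_root R).
by exists pi; split=> //; apply: quotAlg_ker_iso.
Qed.
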